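(* Let $C$ be a non-empty compact convex set in $\mathbb{R}^N$, and let $\zeta$ be a non-empty, convex and compact valued correspondence from $C$ to $\mathbb{R}^N$ (that is, $\zeta(x)\subset\mathbb{R}^N$ is non-empty, convex and compact for every $x\in C$). If $\zeta$ is lower semi-continuous on $C$, then there are some $x \in C$ and $z \in \zeta(x)$ such that $$\langle p,z \rangle \le \langle x,z \rangle \quad \text{for all } p \in C.$$
   Context: $\langle\cdot,\cdot\rangle$ is the standard inner product on $\mathbb{R}^N$. A correspondence $\Gamma: X \rightrightarrows Y$ between non-empty topological spaces assigns to each $x\in X$ a subset $\Gamma(x)\subset Y$. $\Gamma$ is lower semi-continuous at $x \in X$ if, for every open set $V\subset Y$ such that $\Gamma(x)\cap V\neq\emptyset$, there exists a neighborhood $U \subset X$ of $x$ such that $\Gamma(z)\cap V\neq\emptyset$ for all $z\in U$; it is lower semi-continuous on $X$ if it is so at every point of $X$. *)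

(* Defs.v *)
From HB Require Import structures.
From mathcomp Require Import all_boot all_order all_algebra.
From mathcomp Require Import all_classical all_reals all_analysis.

Set Implicit Arguments.
Unset Strict Implicit.
Unset Printing Implicit Defensive.

Import Order.TTheory GRing.Theory Num.Theory.
Import numFieldNormedType.Exports.

Local Open Scope classical_set_scope.
Local Open Scope ring_scope.

Definition inner_product (R : realType) (N : nat) (u v : 'rV[R]_N) : R :=
  \sum_(i < N) u ord0 i * v ord0 i.

(* A correspondence from a subset D of X to Y is a function [X -> set Y] whose
   values outside D are irrelevant. The neighbourhoods of x are those of the
   topology induced by X on D, hence the filter [within D (nbhs x)]. *)
Definition corr_lsc_at (X Y : topologicalType) (D : set X) (G : X -> set Y)
    (x : X) : Prop :=
  forall V : set Y, open V -> G x `&` V !=set0 ->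
    \forall z \near within D (nbhs x), G z `&` V !=set0.

Definition corr_lsc_on (X Y : topologicalType) (D : set X) (G : X -> set Y) :
    Prop :=
  forall x : X, D x -> corr_lsc_at D G x.

(* Main.v *)
Require Import Defs.
From HB Require Import structures.
From mathcomp Require Import all_boot all_order all_algebra.
From mathcomp Require Import zify.

(** The theorem is a variational inequality for a correspondence, and it
    reduces to one for a function: Michael's selection theorem
    ([michael_selection]) gives a continuous [f] on [C] with [f x] in [zeta x],
    and the Hartman-Stampacchia theorem ([variational_inequality]) gives a point
    [x] of [C] at which no [p] in [C] does better than [x] against [f x]; then
    [z := f x].  Lower semi-continuity has no closed-graph consequence, so a
    limit of solutions for approximate selections would not yield a point of
    [zeta x]; an exact selection is essential.

    Michael's theorem.  A partition of unity on the compact set [C] averages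
    points of the values of a lower semi-continuous convex-valued
    correspondence into a continuous function that stays within [e] of these
    values ([approximate_selection]).  Cutting [zeta x] with the open ball of
    radius [2^-k] around the [k]-th approximation preserves lower
    semi-continuity ([corr_lsc_ball]), so the approximations can be refined into
    a uniformly Cauchy sequence; its limit lies in [zeta x], which is closed.

    Hartman-Stampacchia.  The points of [C] that solve the inequality against
    one [p] form a closed set, so by compactness finitely many [p_0 .. p_n]
    suffice.  On their convex hull, parametrized by the simplex, the numbers
    [g_i = <p_i - x, f x>] have barycentric average 0, and an equilibrium
    argument ([simplex_equilibrium]) makes all of them nonpositive.  That
    argument needs the dual form of the Knaster-Kuratowski-Mazurkiewicz lemma
    ([simplex_cover]): closed sets [H_i] that cover the simplex and contain the
    facets [x_i = 0] have a common point.

    The combinatorial core is a lemma of Scarf ([scarf]), which replaces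
    Sperner's lemma and spares any triangulation.  It concerns a finite set
    with one linear order per colour, and is proved by a parity count.
    Applied to the integer points of a dilated simplex, ordered by each
    coordinate, it produces a cluster of nearby points with all the colours
    that matter ([grid_colouring]). *)

Set Implicit Arguments.
Unset Strict Implicit.
Unset Printing Implicit Defensive.

(** * Scarf's lemma on finite sets with several linear orders *)

Section Primitive_sets.
Variables (V I : finType) (r : I -> V -> nat).
Hypothesis r_inj : forall i, injective (r i).
Implicit Types (D S : {set V}) (i j k : I).

(** Scarf's notion: no [v] exceeds the minimum of [D] in all the orders at once.
    The ranks [r i] encode linear orders on [V]. *)
Definition dominant D :=
  [forall v, exists i, [forall s in D, r i v <= r i s]].

Definition min_selection D (m : I -> V) :=
  forall i, m i \in D /\ forall s, s \in D -> r i (m i) <= r i s.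

Lemma dominantP D :
  reflect (forall v, exists i, forall s, s \in D -> r i v <= r i s)
    (dominant D).
Proof.
apply: (iffP forallP) => domD v.
  by have /existsP[i /forall_inP ?] := domD v; exists i.
by have [i ?] := domD v; apply/existsP; exists i; apply/forall_inP.
Qed.

Lemma dominantS D S : D \subset S -> dominant S -> dominant D.
Proof.
move=> /subsetP DS /dominantP domS; apply/dominantP => v.
by have [i Hi] := domS v; exists i => s /DS /Hi.
Qed.

Lemma min_selection_exists D d : d \in D -> exists m, min_selection D m.
Proof.
move=> dD; exists (fun i => [arg min_(x < d in D) r i x]) => i.
by case: arg_minnP => // x xD xmin; split.
Qed.

Lemma min_selection_uniq D m i s : min_selection D m -> s \in D ->
  (forall t, t \in D -> r i s <= r i t) -> m i = s.
Proof.
move=> mD sD smin; have [miD mimin] := mD i.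
by apply/(@r_inj i)/eqP; rewrite eqn_leq mimin // smin.
Qed.

(** Testing dominance at a point of [D] shows that this point is the minimum of
    [D] in some order.  Hence a dominant set has at most [#|I|] elements. *)
Lemma min_selection_imset D m : min_selection D m -> dominant D ->
  m @: [set: I] = D.
Proof.
move=> mD /dominantP domD; apply/setP => s; apply/imsetP/idP.
  by case=> i _ ->; have [] := mD i.
move=> sD; have [i si] := domD s.
by exists i; rewrite ?inE // (min_selection_uniq mD sD).
Qed.

Lemma dominant_min D m v : min_selection D m -> dominant D ->
  exists i, r i v <= r i (m i).
Proof.
move=> mD /dominantP/(_ v)[i Hi]; exists i.
by apply: Hi; have [] := mD i.
Qed.

Lemma card_room D S : D \subset S -> #|D|.+1 = #|I| -> #|S| = #|I| ->
  exists2 x, x \notin D & S = x |: D.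
Proof.
move=> DS cD cS.
have /cards1P[x Ex] : #|S :\: D| == 1.
  by rewrite cardsD (setIidPr DS) cS -cD subSnn.
have : x \in S :\: D by rewrite Ex set11.
rewrite inE => /andP[xD xS]; exists x => //.
by rewrite -(setID S D) (setIidPr DS) Ex setUC.
Qed.

(** Rooms are the dominant sets of maximal size, and their doors are the
    dominant sets with one element fewer; they play the part of the simplices of
    a triangulation and of their facets. *)
Definition rooms : {set {set V}} := [set S | dominant S && (#|S| == #|I|)].

(** A door lies in exactly two rooms.  Since [D] has one element fewer than
    there are orders, exactly two orders [i] and [j] have the same minimum in
    [D].  An element that completes [D] to a room must be the new minimum in one
    of these two orders, say [k], must exceed the old minima in all the others,
    and is the [r k]-greatest such element by dominance.  The last hypothesis
    says that such elements exist; the doors made of the ideal points [w i]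
    below violate it. *)
Lemma card_rooms_above D : D != set0 -> dominant D -> #|D|.+1 = #|I| ->
  (forall i, exists v, forall k, k != i ->
    exists2 d, d \in D & r k d < r k v) ->
  #|[set S in rooms | D \subset S]| = 2.
Proof.
move=> /set0Pn[d0 d0D] domD cD ext.
have [m mD] := min_selection_exists d0D.
have mI := min_selection_imset mD domD.
pose A i := [set v | [forall (k | k != i), r k (m k) < r k v]].
have AP i v : reflect (forall k, k != i -> r k (m k) < r k v) (v \in A i).
  by rewrite inE; exact: forall_inP.
have A0 i : exists v, v \in A i.
  have [v Hv] := ext i; exists v; apply/AP => k /Hv[d dD].
  by apply: leq_ltn_trans; have [_] := mD k; apply.
have [X XP] : exists X : I -> V, forall i, X i \in A i /\
    forall v, v \in A i -> r i v <= r i (X i).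
  exists (fun i => [arg max_(x > xchoose (A0 i) in A i) r i x]) => i.
  case: arg_maxnP => [|x xA xmax]; first exact: xchooseP.
  by split => // v /xmax.
have [i [j [ij mij]]] : exists i j, i != j /\ m i = m j.
  have /injectivePn[i [j ij mij]] : ~~ injectiveb m.
    apply/negP => /injectiveP m_inj; have := card_imset [set: I] m_inj.
    by rewrite mI cardsT -cD => /eqP; rewrite -[_ == _]negbK neq_ltn ltnSn.
  by exists j, i; rewrite eq_sym.
(* Dropping either of the two indices [i], [j] loses no minimum of [D]. *)
have key k : k \in [set i; j] -> forall d, d \in D ->
    exists2 l, l != k & m l = d.
  move=> kij d; rewrite -mI => /imsetP[l _ ->].
  have [->|] := eqVneq l k; last by exists l.
  move: kij; rewrite !inE => /orP[]/eqP ->; last by exists i.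
  by exists j; rewrite // eq_sym.
have XD k : k \in [set i; j] -> X k \notin D.
  move=> kij; apply/negP => /(key k kij)[l lk mlX].
  by have [/AP/(_ l lk)] := XP k; rewrite mlX ltnn.
have Xdom k : k \in [set i; j] -> dominant (X k |: D).
  move=> kij; have [/AP Xk Xmax] := XP k.
  apply/dominantP => v; have [vA|/AP vA] := boolP (v \in A k).
    exists k => s; rewrite !inE => /predU1P[->|sD]; first exact: Xmax.
    apply: (leq_trans (Xmax _ vA)).
    have [l lX] := dominant_min (X k) mD domD.
    have lk : l = k.
      by apply/eqP; apply: contraTT lX => lk; rewrite -ltnNge; exact: Xk.
    by rewrite lk in lX; apply: (leq_trans lX); have [_] := mD k; apply.
  have [l lk vl] : exists2 l, l != k & r l v <= r l (m l).
    apply/exists_inP; apply: contra_notT vA => /exists_inPn vA l lk.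
    by rewrite ltnNge; exact: vA.
  exists l => s; rewrite !inE => /predU1P[->|sD].
    by apply: (leq_trans vl); apply: ltnW; exact: Xk.
  by apply: (leq_trans vl); have [_] := mD l; apply.
have Xij : X i |: D != X j |: D.
  apply/eqP => E; have : X i \in X j |: D by rewrite -E setU11.
  rewrite !inE => /predU1P[Eij|]; last by apply/negP/XD; rewrite !inE eqxx.
  have [l] := dominant_min (X i) mD domD; rewrite leqNgt => /negP; apply.
  have [->|li] := eqVneq l i; last by have [/AP + _] := XP i; apply.
  by rewrite Eij; have [/AP + _] := XP j; apply.
suff -> : [set S in rooms | D \subset S] = [set X i |: D; X j |: D].
  by rewrite cards2 Xij.
have room k : k \in [set i; j] -> (X k |: D \in rooms) && (D \subset X k |: D).
  move=> kij; rewrite inE (Xdom k kij) cardsU1 (XD k kij) add1n cD eqxx /=.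
  exact: subsetUr.
apply/setP => S; apply/idP/idP; last first.
  by move=> /set2P[]->; rewrite inE;
    apply: room; rewrite !inE eqxx ?orbT.
rewrite inE => /andP[]; rewrite inE => /andP[domS /eqP cS] DS.
have [x xD ES] := card_room DS cD cS.
have xS : x \in S by rewrite ES setU11.
have [m' mS] := min_selection_exists xS.
have mSI := min_selection_imset mS domS.
have m'_inj : injective m'.
  have /imset_injP inj : #|m' @: [set: I]| == #|[set: I]|.
    by rewrite mSI cS cardsT.
  by move=> a b; apply: inj; rewrite inE.
have [k _ xk] : exists2 k, k \in [set: I] & x = m' k.
  by apply/imsetP; rewrite mSI.
have m'm l : l != k -> m' l = m l.
  move=> lk; apply/esym/(min_selection_uniq mD).
    have [] := mS l; rewrite {1}ES !inE => /predU1P[|//].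
    by rewrite xk => /m'_inj /eqP; rewrite (negbTE lk).
  move=> t tD; have [_] := mS l; apply.
  by rewrite ES !inE tD orbT.
have kij : k \in [set i; j].
  rewrite !inE; apply: contraNT ij; rewrite negb_or => /andP[ki kj].
  by apply/eqP/m'_inj; rewrite !m'm // eq_sym.
have xA : x \in A k.
  apply/AP => l lk; rewrite ltn_neqAle -(m'm l lk).
  have [_ ->//] := mS l; rewrite andbT; apply/eqP => /(@r_inj l).
  by rewrite xk => /m'_inj /eqP; rewrite (negbTE lk).
have -> : S = X k |: D.
  rewrite ES; congr (_ |: _); apply/(@r_inj k)/eqP.
  have [Xk Xmax] := XP k; rewrite eqn_leq Xmax //=.
  have [l lX] := dominant_min (X k) mS domS.
  have lk : l = k.
    apply/eqP; apply: contraTT lX => lk; rewrite -ltnNge (m'm l lk).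
    by move/AP: Xk; apply.
  by rewrite lk -xk in lX.
by move: kij; rewrite !inE => /orP[]/eqP ->; rewrite eqxx ?orbT.
Qed.

Variable c : V -> I.

(** If [S] misses a colour, removing one point leaves exactly the colours other
    than [i0] either never or in exactly two ways: if [D] is left when [x] is
    removed, the colour of [x] is repeated by a unique [y] in [D], and removing
    [y] instead of [x] leaves the same colours. *)
Lemma even_doors_below i0 S : #|S| = #|I| -> c @: S != [set: I] ->
  ~~ odd #|[set D : {set V} |
    [&& D \subset S, #|D|.+1 == #|I| & c @: D == ~: [set i0]]]|.
Proof.
move=> cS nrain; set DD := [set _ | _].
have [->|/set0Pn[D]] := eqVneq DD set0; first by rewrite cards0.
rewrite inE => /and3P[DS /eqP cD /eqP colD].
have [x xD ES] := card_room DS cD cS.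
have inj D' : D' \in DD -> {in D' &, injective c}.
  rewrite inE => /and3P[_ /eqP cD' /eqP col]; apply/imset_injP.
  by rewrite col cardsC1 -cD'.
have cx : c x \in c @: D.
  rewrite colD !inE; apply: contraNneq nrain => cx.
  by rewrite ES imsetU1 colD cx setUCr.
have [y yD cxy] := imsetP cx.
have xy : x != y by apply: contraNneq xD => ->.
have yS : y \in S by rewrite ES !inE yD orbT.
suff -> : DD = [set D; S :\ y].
  suff -> : #|[set D; S :\ y]| = 2 by [].
  rewrite cards2; case: eqVneq => // E.
  by move: yD; rewrite E !inE eqxx.
apply/setP => D'; apply/idP/idP => [D'D|].
  have := D'D; rewrite inE => /and3P[D'S /eqP cD' /eqP col].
  have [z zD' ES'] := card_room D'S cD' cS.
  have D'E : D' = S :\ z by rewrite ES' setU1K.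
  have : z \in [set x; y].
    rewrite !inE; apply: contraNT xy; rewrite negb_or => /andP[zx zy].
    have xD' : x \in D' by rewrite D'E !inE eq_sym zx ES !inE eqxx.
    have yD' : y \in D' by rewrite D'E !inE eq_sym zy.
    by apply/eqP/(inj _ D'D).
  rewrite !inE D'E => /orP[]/eqP ->; last by rewrite eqxx orbT.
  by rewrite ES setU1K // eqxx.
rewrite !inE => /orP[]/eqP ->; first by rewrite DS cD colD !eqxx.
rewrite subD1set /=; have := cardsD1 y S; rewrite yS add1n cS => <-.
rewrite eqxx /= -colD eqEsubset; apply/andP; split.
  apply/subsetP => _ /imsetP[z zS ->]; move: zS; rewrite ES !inE.
  by case/andP=> _ /predU1P[->//|zD]; exact: imset_f.
apply/subsetP => _ /imsetP[z zD ->]; have [->|zy] := eqVneq z y.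
  by rewrite -cxy; apply: imset_f; rewrite ES !inE eqxx andbT.
by apply: imset_f; rewrite ES !inE zD zy orbT.
Qed.

(** The elements [w i] are ideal points that close up the boundary: each is
    lowest in its own order and above all the ordinary points in the others. *)
Variable w : I -> V.
Hypothesis w_low : forall i v, v != w i -> r i (w i) < r i v.
Hypothesis w_high : forall i j v, j != i -> v \notin codom w ->
  r i v < r i (w j).
Hypothesis c_w : cancel w c.

(** Count modulo 2 the pairs of a room and one of its doors coloured by all the
    colours but [i0].  Each such door lies in two rooms, except the ideal door
    [D0], which lies in one, so the total is odd; rooms that are not rainbow
    contribute evenly, so some room is rainbow. *)
Lemma rainbow_room v0 : v0 \notin codom w ->
  exists S, [/\ dominant S, #|S| = #|I| & c @: S = [set: I]].
Proof.
move=> v0w; pose i0 := c v0.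
have [/exists_inP[S]|/exists_inPn norain] :=
    boolP [exists S in rooms, c @: S == [set: I]].
  by rewrite inE => /andP[domS /eqP cS] /eqP colS; exists S.
have w_inj : injective w := can_inj c_w.
pose isdoor D := [&& dominant D, #|D|.+1 == #|I| & c @: D == ~: [set i0]].
pose doors := [set D | isdoor D].
pose D0 := w @: (~: [set i0]).
have D0w j : (w j \in D0) = (j != i0).
  by rewrite (mem_imset _ _ w_inj) !inE.
have D0n v : v \notin codom w -> v \notin D0.
  by apply: contra => /imsetP[j _ ->]; exact: codom_f.
have cardI : #|~: [set i0]|.+1 = #|I|.
  by rewrite cardsC1 prednK //; apply/card_gt0P; exists i0.
have cardD0 : #|D0|.+1 = #|I| by rewrite card_imset.
have dbl : \sum_(D in doors) #|[set S in rooms | D \subset S]| =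
           \sum_(S in rooms) #|[set D in doors | D \subset S]|.
  under eq_bigr do rewrite -sum1dep_card big_mkcondr.
  rewrite exchange_big /=; apply: eq_bigr => S _.
  by rewrite -sum1dep_card big_mkcondr.
have [z zw zmax] : exists2 z, z \notin codom w &
    forall v, v \notin codom w -> r i0 v <= r i0 z.
  pose z := [arg max_(x > v0 | x \notin codom w) r i0 x]; exists z.
    by rewrite /z; case: arg_maxnP.
  by rewrite /z; case: arg_maxnP => // x xw xmax v /xmax.
have rooms0 : [set S in rooms | D0 \subset S] = [set z |: D0].
  apply/setP => S; rewrite !inE; apply/idP/eqP => [|->]; last first.
    rewrite subsetUr andbT cardsU1 (D0n _ zw) add1n cardD0 eqxx andbT.
    apply/dominantP => v; have [/codomP[j ->]|vw] := boolP (v \in codom w).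
      exists j => s _; have [->//|sj] := eqVneq s (w j).
      by apply: ltnW; exact: w_low.
    exists i0 => s; rewrite !inE => /predU1P[->|]; first exact: zmax.
    move=> /imsetP[j]; rewrite !inE => ji ->.
    by apply: ltnW; exact: w_high.
  move=> /andP[/andP[/dominantP domS /eqP cS] DS].
  have [x xD ES] := card_room DS cardD0 cS.
  have zlow k : w k \in S -> ~ (forall s, s \in S -> r k z <= r k s).
    move=> wS /(_ _ wS); rewrite leqNgt w_low //.
    by apply: contraNneq zw => ->; exact: codom_f.
  have xw : x \notin codom w.
    apply/negP => /codomP[j xj]; have [k] := domS z; apply: zlow.
    have ji : j = i0 by apply/eqP; move: xD; rewrite xj D0w negbK.
    by rewrite ES !inE D0w xj ji (inj_eq w_inj) orbN.
  have [k zk] := domS z.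
  have ki : k = i0.
    apply/eqP; apply: contraPT zk => ki; apply: zlow.
    by rewrite ES !inE D0w ki orbT.
  rewrite ES; congr (_ |: _); apply/(@r_inj i0)/eqP.
  rewrite eqn_leq zmax //= -ki; apply: zk.
  by rewrite ES !inE eqxx.
have D0door : D0 \in doors.
  rewrite inE; apply/and3P; split; last 1 first.
  - by rewrite -imset_comp (eq_imset _ c_w) imset_id.
  - have : z |: D0 \in [set S in rooms | D0 \subset S] by rewrite rooms0 set11.
    by rewrite !inE => /andP[/andP[domz _] D0z]; exact: dominantS domz.
  - by rewrite cardD0.
have even_rooms D : D \in doors -> D != D0 ->
    #|[set S in rooms | D \subset S]| = 2.
  rewrite inE => /and3P[domD /eqP cD /eqP colD] DD0.
  have [d dD dw] : exists2 d, d \in D & d \notin codom w.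
    apply/exists_inP; apply: contraNT DD0 => /exists_inPn Dw.
    have wc d : d \in D -> w (c d) = d.
      by move=> /Dw; rewrite negbK => /codomP[j ->]; rewrite c_w.
    rewrite /D0 -colD -imset_comp.
    by apply/eqP/setP => v; apply/idP/imsetP => [vD|[u uD ->]];
      [exists v; rewrite //= wc|rewrite /= wc].
  apply: card_rooms_above => //; first by apply/set0Pn; exists d.
  move=> i; exists (w i) => k ki.
  have [wkD|wkD] := boolP (w k \in D); last first.
    by exists d; rewrite // w_high // eq_sym.
  by exists (w k) => //; apply: w_low; rewrite (inj_eq w_inj) eq_sym.
have : odd (\sum_(D in doors) #|[set S in rooms | D \subset S]|).
  rewrite (bigD1 D0) //= rooms0 cards1 oddD /= -dvdn2.
  by apply: dvdn_sum => D /andP[Dd DD0]; rewrite even_rooms.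
rewrite dbl => odd_total; exfalso; move: odd_total; apply/negP; rewrite -dvdn2.
apply: dvdn_sum => S SR; rewrite dvdn2.
have := norain _ SR; move: SR; rewrite inE => /andP[domS /eqP cS] rainS.
suff -> : [set D in doors | D \subset S] = [set D : {set V} |
    [&& D \subset S, #|D|.+1 == #|I| & c @: D == ~: [set i0]]].
  exact: even_doors_below.
apply/setP => D; rewrite !inE /isdoor andbC.
case: (boolP (D \subset S)) => // DS.
by rewrite (dominantS DS domS).
Qed.

End Primitive_sets.

(** This is [rainbow_room] for [T] enlarged by one ideal point [inr i] for each
    colour: [S] consists of the ordinary points of the room and [C] of the
    colours whose ideal point is absent. *)
Lemma scarf (T I : finType) (r : I -> T -> nat) (c : T -> I) (t0 : T) :
  (forall i, injective (r i)) ->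
  exists (S : {set T}) (C : {set I}), [/\ C != set0, C \subset c @: S &
    forall t, exists2 i, i \in C & forall s, s \in S -> r i t <= r i s].
Proof.
move=> r_inj.
pose top i := \max_t r i t.
(* Ordinary points have rank at most [(top i).+1], leaving rank 0 to the
   ideal point of [i] and the ranks above to the other ideal points. *)
pose rho i (v : T + I) := match v with
  | inl t => (r i t).+1
  | inr j => if j == i then 0 else (top i).+2 + enum_rank j end.
have rtop i t : r i t <= top i by exact: leq_bigmax.
have rho_inj i : injective (rho i).
  move=> [t|j] [u|k] /=.
  - by case=> /r_inj ->.
  - by case: eqP => // _ E; have := rtop i t; lia.
  - by case: eqP => // _ E; have := rtop i u; lia.
  - case: eqP => [->|_]; case: eqP => [->|_] //; try lia.
    by move=> /addnI /ord_inj /enum_rank_inj ->.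
pose col (v : T + I) := match v with inl t => c t | inr j => j end.
have codom_inr v : (v \notin codom inr) -> exists t : T, v = inl t.
  by case: v => [t _|j]; [exists t|rewrite codom_f].
have low i v : v != inr i -> rho i (inr i) < rho i v.
  case: v => [t|j] ji /=; rewrite eqxx //.
  by have [E|//] := eqVneq j i; rewrite E eqxx in ji.
have high i j v : j != i -> v \notin codom inr -> rho i v < rho i (inr j).
  move=> /negbTE ji /codom_inr[t ->] /=; rewrite ji.
  by have := rtop i t; lia.
have t0w : (inl t0 : T + I) \notin codom inr by apply/negP => /codomP[].
have [S [/dominantP domS cS colS]] :=
  rainbow_room rho_inj low high (fun=> erefl : col (inr _) = _) t0w.
pose C := [set i | inr i \notin S].
have dom t : exists2 i, i \in C & forall s, inl s \in S -> r i t <= r i s.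
  have [i ti] := domS (inl t); exists i; last by move=> s /ti.
  by rewrite inE; apply/negP => /ti /=; rewrite eqxx.
exists [set s | inl s \in S], C; split.
- by have [i iC _] := dom t0; apply/set0Pn; exists i.
- apply/subsetP => i; rewrite inE => iS.
  have /imsetP[[s|j] sS ij] : i \in col @: S by rewrite colS.
  + by rewrite ij; apply: imset_f; rewrite inE.
  + by move: iS; rewrite ij /= sS.
- by move=> t; have [i iC Hi] := dom t; exists i => // s; rewrite inE => /Hi.
Qed.

(** * Colourings of the integer points of a simplex *)

(** The grid consists of the points with nonnegative integer coordinates of sum
    [m].  Apply [scarf] to the orders given by the coordinates.  For [mu i] the
    least [i]-th coordinate in [S], dominance forbids a grid point above [mu] at
    all the coordinates in [C], whence [m < \sum_(i in C) mu i + #|C|].  For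
    a point of [S], the excesses over [mu] at the indices in [C] and the
    coordinates outside [C] therefore sum to less than [#|C|], so [S] is a tight
    cluster close to the facets [t i = 0] for [i] outside [C].  The colours in
    [C] occur in [S]; for [i] outside [C], moving the [i]-th coordinate of a
    point of [S] to another index gives a nearby grid point on the facet
    [t i = 0]. *)
Lemma grid_colouring (I : finType) (i0 : I) (m : nat)
    (c : {ffun I -> 'I_m.+1} -> I) :
  exists2 s : {ffun I -> 'I_m.+1}, \sum_i s i = m &
    forall i, exists t : {ffun I -> 'I_m.+1}, [/\ \sum_i t i = m,
      forall j, t j <= s j + #|I| /\ s j <= t j + #|I| &
      c t = i \/ t i = 0 :> nat].
Proof.
pose T : finType := {t : {ffun I -> 'I_m.+1} | \sum_i t i == m}.
have mkgrid (f : I -> nat) : \sum_i f i = m ->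
    exists t : T, forall i, val t i = f i :> nat.
  move=> fm; have fle i : f i < m.+1 by rewrite ltnS -fm (bigD1 i) //= leq_addr.
  have sumf :
      \sum_i (finfun (fun i => Ordinal (fle i)) : {ffun I -> 'I_m.+1}) i == m.
    by rewrite -[X in _ == X]fm; apply/eqP/eq_bigr => i _; rewrite ffunE.
  exists (exist (fun t : {ffun I -> 'I_m.+1} => \sum_i t i == m) _ sumf) => i.
  by rewrite /= ffunE.
(* The order by the [i]-th coordinate, with ties broken by an enumeration. *)
pose r i (t : T) := val t i * #|T| + enum_rank t.
have r_le i t u : r i t <= r i u -> val t i <= val u i.
  rewrite -ltnS; apply: contraTT; rewrite -leqNgt -ltnNge => ut.
  apply: leq_trans (leq_addr _ _); apply: leq_trans (leq_mul ut (leqnn _)).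
  by rewrite /r mulSn [#|T| + _]addnC ltn_add2l.
have r_inj i : injective (r i).
  move=> t u E; have /eqP : val t i == val u i :> nat.
    by rewrite eqn_leq !r_le // E.
  by move=> E'; move: E; rewrite /r E' => /addnI /ord_inj /enum_rank_inj.
have [t0 _] : exists t : T,
    forall i, val t i = (if i == i0 then m else 0) :> nat.
  by apply: mkgrid; rewrite -big_mkcond big_pred1_eq.
have [S [C [/set0Pn[i1 i1C] /subsetP CS dom]]] :=
  scarf (fun t : T => c (val t)) t0 r_inj.
have [s1 s1S _] := imsetP (CS _ i1C).
pose mu i : nat := val [arg min_(s < s1 in S) val s i] i.
have mu_le i s : s \in S -> mu i <= val s i.
  by rewrite /mu; case: arg_minnP => // x xS; apply.
have dom_mu (t : T) : exists2 i, i \in C & val t i <= mu i.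
  have [i iC Hi] := dom t; exists i => //.
  by rewrite /mu; case: arg_minnP => // x /Hi /r_le.
have mu_sum : m < \sum_(i in C) mu i + #|C|.
  rewrite ltnNge; apply/negP => le_m.
  have split_m : \sum_(i in C) (mu i).+1 <= m.
    by under eq_bigr do rewrite -addn1; rewrite big_split /= sum1_card.
  (* Otherwise put [(mu i).+1] at each index of [C] and the rest at [i1]. *)
  pose rest := m - \sum_(i in C) (mu i).+1.
  have [t tE] : exists t : T, forall i, val t i =
      (if i \in C then (mu i).+1 else 0) + (if i == i1 then rest else 0) :> nat.
    apply: mkgrid; rewrite big_split /= -!big_mkcond /= big_pred1_eq.
    by rewrite subnKC.
  by have [i iC] := dom_mu t; rewrite tE iC; lia.
have near s i : s \in S -> val s i <= (if i \in C then mu i else 0) + #|I|.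
  move=> sS; have /eqP := valP s; rewrite (bigD1 i) //= => sum_s.
  have card_C : #|C| <= #|I| by exact: max_card.
  have mu_s : \sum_(j in C) mu j <=
      \sum_(j in C | j != i) val s j + (if i \in C then mu i else 0).
    have [iC|iC] := boolP (i \in C).
      rewrite (bigD1 i) //= addnC leq_add2r.
      by apply: leq_sum => j /andP[_ _]; apply: mu_le.
    rewrite addn0 [leqRHS](eq_bigl (mem C)).
      by apply: leq_sum => j _; apply: mu_le.
    by move=> j /=; case: eqVneq => [->|]; rewrite ?andbT // (negbTE iC).
  have rest_s : \sum_(j in C | j != i) val s j <= \sum_(j | j != i) val s j.
    rewrite [leqRHS](bigID (mem C)) /=.
    rewrite (eq_bigl (fun j => (j != i) && (j \in C))).
      exact: leq_addr.
    by move=> j; rewrite andbC.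
  have arith a k K x y u v : m < a + k -> k <= K -> a <= x + u -> x <= y ->
    v + y = m -> v <= u + K by lia.
  exact: arith mu_sum card_C mu_s rest_s sum_s.
have close s t i : s \in S -> t \in S -> val s i <= val t i + #|I|.
  move=> sS tS; apply: leq_trans (near _ i sS) _; rewrite leq_add2r.
  by case: ifP => // _; apply: mu_le.
exists (val s1); first exact/eqP/(valP s1).
move=> i; have [iC|iC] := boolP (i \in C).
  have [t tS ct] := imsetP (CS _ iC); exists (val t); split; last by left.
    exact/eqP/(valP t).
  by move=> j; split; apply: close.
have ne : i1 != i by apply: contraNneq iC => <-.
pose f j :=
  if j == i then 0 else val s1 j + (if j == i1 then val s1 i : nat else 0).
have [t tE] : exists t : T, forall j, val t j = f j :> nat.
  apply: mkgrid; rewrite -[RHS](eqP (valP s1)).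
  rewrite (bigD1 i) //= [in RHS](bigD1 i) //=.
  rewrite {1}/f eqxx add0n (bigD1 i1) //= [in RHS](bigD1 i1) //= {1}/f.
  rewrite (negbTE ne) eqxx -addnA addnCA; congr (_ + (_ + _)).
  apply: eq_bigr => j /andP[ji ji1].
  by rewrite /f (negbTE ji) (negbTE ji1) addn0.
exists (val t); split; [exact/eqP/(valP t)| |by right; rewrite tE /f eqxx].
move=> j; rewrite tE /f; have := near _ i s1S; rewrite (negbTE iC) add0n => si.
case: eqVneq => [->|_]; first by rewrite leq0n add0n.
by case: eqVneq => _; rewrite ?addn0 ?leq_addr // leq_add2l -addnA leq_addr.
Qed.

From mathcomp Require Import all_classical all_reals all_analysis.
From mathcomp Require Import ring lra.

Import Order.TTheory GRing.Theory Num.Theory.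
Import numFieldNormedType.Exports.

Local Open Scope classical_set_scope.
Local Open Scope ring_scope.

(** * Convex combinations and continuity *)

Lemma convex_setP (R : realType) (V : lmodType R) (A : set V) : convex_set A ->
  forall (x y : V) (t : R), 0 <= t <= 1 -> A x -> A y ->
  A (t *: x + (1 - t) *: y).
Proof.
move=> convA x y t /andP[t0 t1] /mem_set Ax /mem_set Ay.
exact: set_mem (convA x y (Itv01 t0 t1) Ax Ay).
Qed.

(** Points of zero weight are exempt from belonging to [A], because the weights
    are partition-of-unity functions, which control a point only where its
    weight is positive. *)
Lemma convex_barycentre (R : realType) (V : lmodType R) (A : set V) (I : eqType)
    (s : seq I) (a : I -> R) (v : I -> V) :
  convex_set A -> (forall i, 0 <= a i) ->
  (forall i, i \in s -> 0 < a i -> A (v i)) ->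
  0 < \sum_(i <- s) a i ->
  A ((\sum_(i <- s) a i)^-1 *: \sum_(i <- s) a i *: v i).
Proof.
move=> convA a0; elim: s => [|i s IH] Av; first by rewrite big_nil ltxx.
have {}IH := IH (fun j js => Av j (@mem_behead _ (i :: s) j js)).
rewrite !big_cons; set b := \sum_(j <- s) a j in IH *.
set w := \sum_(j <- s) a j *: v j in IH *.
have b0 : 0 <= b by apply: sumr_ge0.
have [ai0|ai0] : a i = 0 \/ 0 < a i.
  by have := a0 i; rewrite le_eqVlt => /predU1P[<-|]; [left|right].
  by rewrite ai0 scale0r !add0r.
move=> ab0; have [b_eq0|b_gt0] : b = 0 \/ 0 < b.
  by move: b0; rewrite le_eqVlt => /predU1P[<-|]; [left|right].
  have -> : w = 0.
    rewrite /w; elim: (s) (b_eq0 : \sum_(j <- s) a j = 0) => [|j r IHr].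
      by rewrite !big_nil.
    rewrite !big_cons.
    move=> /eqP; rewrite paddr_eq0 ?sumr_ge0// => /andP[/eqP -> /eqP /IHr ->].
    by rewrite scale0r addr0.
  rewrite b_eq0 !addr0 scalerA mulVf ?gt_eqF// scale1r.
  exact: Av (mem_head _ _) _.
have ab : a i + b != 0 by rewrite gt_eqF.
have -> : (a i + b)^-1 *: (a i *: v i + w) =
    (a i / (a i + b)) *: v i + (1 - a i / (a i + b)) *: (b^-1 *: w).
  rewrite scalerDr !scalerA mulrC; congr (_ + _ *: _).
  by field; rewrite ab gt_eqF.
apply: (convex_setP convA); [|exact: Av (mem_head _ _) _|exact: IH].
by rewrite divr_ge0 ?addr_ge0//= ler_pdivrMr// mul1r lerDl.
Qed.

Lemma cvg_sumr (R : realType) (V : normedModType R) (T : Type)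
    (F : set_system T) {FF : Filter F} (I : Type) (s : seq I) (f : I -> T -> V)
    (l : I -> V) :
  (forall i, f i x @[x --> F] --> l i) ->
  \sum_(i <- s) f i x @[x --> F] --> \sum_(i <- s) l i.
Proof. by move=> fl; apply: cvg_big => // ?; exact: add_continuous. Qed.

Lemma closed_within_ge0 (R : realType) (T : topologicalType) (A : set T)
    (h : T -> R) :
  closed A -> {within A, continuous h} -> closed (A `&` [set x | 0 <= h x]).
Proof.
move=> clA /continuous_closedP ch; rewrite closed_setSI//.
exact: (ch _ (@closed_ge R 0)).
Qed.

Lemma rV_norm_le (R : realType) n (x : 'rV[R]_n) e : 0 <= e ->
  (forall i, `|x ord0 i| <= e) -> `|x| <= e.
Proof.
move=> e0 xe; rewrite /Num.norm/= mx_normrE; apply/bigmax_leP; split => //.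
by move=> [i j] _ /=; rewrite ord1.
Qed.

(** * Closed covers and equilibria on the simplex *)

Definition simplex (R : realType) n : set 'rV[R]_n :=
  [set x | (forall i, 0 <= x ord0 i) /\ \sum_i x ord0 i = 1].

Lemma closed_simplex (R : realType) n : closed (@simplex R n).
Proof.
have -> : @simplex R n = \bigcap_(i in [set: 'I_n]) [set x | 0 <= x ord0 i] `&`
    [set x | \sum_i x ord0 i = 1].
  by apply/seteqP; split => x [x0 x1]; split => //; [move=> i _|move=> i];
    exact: x0.
apply: closedI.
  apply: closed_bigI => i _.
  apply: (@preimage_closed _ _ (fun x : 'rV[R]_n => x ord0 i) [set r | 0 <= r]).
    by move=> x _; exact: coord_continuous.
  exact: closed_ge.
apply: (@preimage_closed _ _ (fun x : 'rV[R]_n => \sum_i x ord0 i) [set 1]).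
  move=> x _; apply: (@cvg_sumr R R^o _ (nbhs x) _) => i.
  exact: coord_continuous.
exact: closed_eq.
Qed.

Lemma compact_simplex (R : realType) n : compact (@simplex R n).
Proof.
apply: bounded_closed_compact; last exact: closed_simplex.
exists 1; split => // M M1 x [x0 x1] /=; apply/ltW/(le_lt_trans _ M1).
apply: rV_norm_le => // i; rewrite ger0_norm// -x1 (bigD1 i)//= lerDl.
by apply: sumr_ge0 => j _.
Qed.

(** This is [grid_colouring] on the grid of mesh [1 / k.+1], where a grid point
    is coloured by the index of a set [H i] that contains it. *)
Lemma simplex_near_cover (R : realType) n (H : 'I_n.+1 -> set 'rV[R]_n.+1) k :
  (forall x, simplex x -> exists i, H i x) ->
  (forall i x, simplex x -> x ord0 i = 0 -> H i x) ->
  exists x, simplex x /\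
    forall i, exists2 y, H i y & `|x - y| <= n.+1%:R / k.+1%:R.
Proof.
move=> cover face.
pose pt (t : {ffun 'I_n.+1 -> 'I_k.+2}) : 'rV[R]_n.+1 :=
  \row_i ((t i)%:R / k.+1%:R).
have pt_simplex (t : {ffun 'I_n.+1 -> 'I_k.+2}) :
    (\sum_i t i = k.+1)%N -> simplex (pt t).
  move=> sum_t; split => [i|]; first by rewrite mxE divr_ge0.
  under eq_bigr do rewrite mxE.
  by rewrite -mulr_suml -natr_sum sum_t divff.
pose c (t : {ffun 'I_n.+1 -> 'I_k.+2}) := xget ord0 [set i | H i (pt t)].
have cP (t : {ffun 'I_n.+1 -> 'I_k.+2}) :
    (\sum_i t i = k.+1)%N -> H (c t) (pt t).
  by move=> /pt_simplex/cover; exact: (@xgetPex _ ord0 [set i | H i (pt t)]).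
have [s sum_s sP] := grid_colouring ord0 c.
exists (pt s); split; first exact: pt_simplex.
move=> i; have [t [sum_t st ct]] := sP i; exists (pt t).
  case: ct => [<-|ti]; first exact: cP.
  by apply: face; [exact: pt_simplex|rewrite mxE ti mul0r].
apply: rV_norm_le => [|j]; first by rewrite divr_ge0.
rewrite !mxE -mulrBl normrM [X in _ * X]ger0_norm ?invr_ge0//.
rewrite ler_wpM2r ?invr_ge0//; have [] := st j; rewrite card_ord.
rewrite -!(ler_nat R) !natrD => h1 h2.
by rewrite ler_norml; apply/andP; split; lra.
Qed.

(** A cluster point of the near-solutions for finer and finer grids lies in the
    closure of each [H i]. *)
Lemma simplex_cover (R : realType) n (H : 'I_n.+1 -> set 'rV[R]_n.+1) :
  (forall i, closed (H i)) -> (forall x, simplex x -> exists i, H i x) ->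
  (forall i x, simplex x -> x ord0 i = 0 -> H i x) ->
  exists2 x, simplex x & forall i, H i x.
Proof.
move=> clH cover face.
have /choice[u uP] := fun k => simplex_near_cover k cover face.
have u_simplex : (u @ \oo) (@simplex R n.+1).
  by exists 0%N => // k _; exact: (uP k).1.
have [p [p_simplex p_cluster]] := @compact_simplex R n.+1 (u @ \oo) _ u_simplex.
exists p => // i; apply: clH => B /nbhs_ballP[e /= e0 eB].
have e2 : 0 < e / 2 by rewrite divr_gt0.
have e3 : 0 < e / 2 / n.+1%:R by rewrite divr_gt0.
have far : (u @ \oo) [set u k | k in [set k | n.+1%:R / k.+1%:R < e / 2]].
  apply: filterS (near_infty_natSinv_lt (PosNum e3)) => k /= ke.
  by exists k => //=; rewrite mulrC -ltr_pdivlMr.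
have [_ [[k /= ke <-] pk]] := p_cluster _ _ far (nbhsx_ballx p _ e2).
have [y Hy uy] := (uP k).2 i; exists y; split => //; apply: eB.
rewrite -ball_normE /= in pk *; rewrite -(subrKA (u k)).
apply: (le_lt_trans (ler_normD _ _)).
by rewrite [e]splitr ltrD// (le_lt_trans uy).
Qed.

(** This is the existence of a price equilibrium under Walras's law.  Up to a
    factor 2, [pos i] is the positive part of [g i]; the sets
    [pos i >= x_i * \sum_j pos j] cover the simplex because the differences
    [h i] sum to 0, and they contain the facets.  At a common point all the
    differences vanish, so [pos] is proportional to [x]; then Walras's law says
    that the nonnegative terms [pos i x * g i x] sum to 0. *)
Lemma simplex_equilibrium (R : realType) n (g : 'I_n.+1 -> 'rV[R]_n.+1 -> R) :
  (forall i, {within @simplex R n.+1, continuous (g i)}) ->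
  (forall x, simplex x -> \sum_i x ord0 i * g i x = 0) ->
  exists2 x, simplex x & forall i, g i x <= 0.
Proof.
move=> cg walras.
pose pos i x := `|g i x| + g i x.
have pos0 i x : 0 <= pos i x by rewrite /pos -lerBlDr sub0r -normrN ler_norm.
pose h i x := pos i x - x ord0 i * \sum_j pos j x.
have ch i : {within @simplex R n.+1, continuous (h i)}.
  apply/subspace_continuousP => x Dx.
  have cpos j : pos j y @[y --> within (@simplex R n.+1) (nbhs x)] --> pos j x.
    have /subspace_continuousP/(_ x Dx) gj := cg j.
    by apply: cvgD => //; apply: cvg_norm.
  apply: cvgB; first exact: cpos.
  apply: cvgM; last exact: cvg_sumr.
  by apply: cvg_within_filter; exact: coord_continuous.
have sum_h x : simplex x -> \sum_i h i x = 0.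
  by move=> [_ x1]; rewrite sumrB -mulr_suml x1 mul1r subrr.
have [|||x Dx hx] := @simplex_cover R n
  (fun i => @simplex R n.+1 `&` [set x | 0 <= h i x]).
- by move=> i; apply: closed_within_ge0 => //; exact: closed_simplex.
- move=> x Dx; apply: contrapT => /forallNP hx.
  suff : \sum_i h i x < 0 by rewrite sum_h// ltxx.
  have lt0 i : h i x < 0 by rewrite ltNge; apply/negP => hi; exact: (hx i).
  rewrite big_ord_recl/=; apply: (@le_lt_trans _ _ (h ord0 x)) => //.
  by rewrite gerDl; apply: sumr_le0 => i _; exact/ltW.
- by move=> i x Dx xi; split => //; rewrite /= /h xi mul0r subr0.
exists x => // i.
have h0 j : h j x = 0.
  apply/eqP; move: (sum_h x Dx) => /eqP; rewrite psumr_eq0; last first.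
    by move=> k _; have [] := hx k.
  by move=> /allP/(_ j); rewrite mem_index_enum; apply.
have posE j : pos j x = x ord0 j * \sum_k pos k x.
  by apply/eqP; rewrite -subr_eq0; exact/eqP/h0.
have [x0 x1] := Dx.
have sum_pg : \sum_j pos j x * g j x == 0.
  by under eq_bigr do rewrite posE mulrAC; rewrite -mulr_suml walras// mul0r.
have pg j : 0 <= pos j x * g j x.
  have [g0|g0] := lerP 0 (g j x); last by rewrite /pos ltr0_norm// addNr mul0r.
  by rewrite mulr_ge0// pos0.
move: sum_pg; rewrite psumr_eq0; last by move=> j _; exact: pg.
move=> /allP/(_ i); rewrite mem_index_enum => /(_ isT) /= /eqP pgi.
rewrite leNgt; apply/negP => gi; suff : 0 < pos i x * g i x by rewrite pgi ltxx.
by rewrite mulr_gt0// /pos gtr0_norm// addr_gt0.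
Qed.

(** * Variational inequalities for continuous functions *)

Lemma inner_product_suml (R : realType) N n (a : 'I_n -> R)
    (p : 'I_n -> 'rV[R]_N) (v : 'rV[R]_N) :
  inner_product (\sum_i a i *: p i) v = \sum_i a i * inner_product (p i) v.
Proof.
rewrite /inner_product; under [RHS]eq_bigr do rewrite mulr_sumr.
rewrite exchange_big /=; apply: eq_bigr => j _.
by rewrite summxE mulr_suml; apply: eq_bigr => i _; rewrite mxE mulrA.
Qed.

Lemma cvg_inner_product (R : realType) N (T : Type) (F : set_system T)
    {FF : Filter F} (u v : T -> 'rV[R]_N) (a b : 'rV[R]_N) :
  u x @[x --> F] --> a -> v x @[x --> F] --> b ->
  inner_product (u x) (v x) @[x --> F] --> inner_product a b.
Proof.
have coord (w : T -> 'rV[R]_N) (c : 'rV[R]_N) i : w x @[x --> F] --> c ->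
    w x ord0 i @[x --> F] --> c ord0 i.
  move=> wc; apply: (cvg_comp w (fun M => M ord0 i) wc).
  exact: coord_continuous.
move=> ua vb; rewrite /inner_product.
apply: (@cvg_sumr R R^o T F FF _ _ (fun i x => u x ord0 i * v x ord0 i)
  (fun i => a ord0 i * b ord0 i)) => i.
by apply: cvgM; exact: coord.
Qed.

Lemma within_continuous_comp (X Y Z : topologicalType) (A : set X) (B : set Y)
    (f : X -> Y) (g : Y -> Z) :
  {within A, continuous f} -> (forall x, A x -> B (f x)) ->
  {within B, continuous g} -> {within A, continuous (g \o f)}.
Proof.
move=> /subspace_continuousP cf AB /subspace_continuousP cg.
apply/subspace_continuousP => x Ax U /(cg _ (AB _ Ax)) BU.
have : \forall y \near x, A y -> B (f y) -> U (g (f y)) := cf x Ax _ BU.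
by apply: filterS => y BUy Ay; apply: BUy => //; exact: AB.
Qed.

(** The point is sought in the convex hull of the [p i], as the image [phi l] of
    a point of the simplex.  The gains [g i l] average to 0 with the weights
    [l], since [phi l] is the barycentre. *)
Lemma variational_inequality_finite (R : realType) N (C : set 'rV[R]_N)
    (f : 'rV[R]_N -> 'rV[R]_N) n (p : 'I_n.+1 -> 'rV[R]_N) :
  convex_set C -> {within C, continuous f} -> (forall i, C (p i)) ->
  exists2 x, C x & forall i, inner_product (p i) (f x) <= inner_product x (f x).
Proof.
move=> convC cf Cp.
pose phi (l : 'rV[R]_n.+1) := \sum_i l ord0 i *: p i.
have phiC l : simplex l -> C (phi l).
  move=> [l0 l1].
  have := @convex_barycentre _ _ C _ (index_enum 'I_n.+1) (l ord0) p.
  by rewrite l1 invr1 scale1r; apply.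
have cphi : {within @simplex R n.+1, continuous phi}.
  apply: continuous_subspaceT => l; apply: (@cvg_sumr _ _ _ (nbhs l) _) => i.
  by apply: cvgZr_tmp; exact: coord_continuous.
have cfphi := within_continuous_comp cphi phiC cf.
pose g i l :=
  inner_product (p i) (f (phi l)) - inner_product (phi l) (f (phi l)).
have [||l Dl gl] := @simplex_equilibrium R n g.
- move=> i; apply/subspace_continuousP => l Dl.
  have {}cphi := (@subspace_continuousP _ _ _ phi).1 cphi l Dl.
  have {}cfphi := (@subspace_continuousP _ _ _ (f \o phi)).1 cfphi l Dl.
  by apply: cvgB; apply: cvg_inner_product => //; exact: cvg_cst.
- move=> l [_ l1]; rewrite /g; under eq_bigr do rewrite mulrBr.
  by rewrite sumrB -mulr_suml l1 mul1r -inner_product_suml subrr.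
exists (phi l); first exact: phiC.
by move=> i; have := gl i; rewrite subr_le0.
Qed.

(** The solution sets for the single points [p] are closed in the compact set
    [C], and finitely many of them meet by the finite case. *)
Lemma variational_inequality (R : realType) N (C : set 'rV[R]_N)
    (f : 'rV[R]_N -> 'rV[R]_N) :
  C !=set0 -> compact C -> convex_set C -> {within C, continuous f} ->
  exists2 x, C x &
    forall p, C p -> inner_product p (f x) <= inner_product x (f x).
Proof.
move=> [p0 Cp0] compC convC cf.
have clC : closed C by apply: compact_closed => //; exact: norm_hausdorff.
pose sol p :=
  C `&` [set x | 0 <= inner_product x (f x) - inner_product p (f x)].
have sol_closed p : closed (sol p).
  apply: closed_within_ge0 => //; apply/subspace_continuousP => x Cx.
  have {}cf := (@subspace_continuousP _ _ _ f).1 cf x Cx.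
  apply: cvgB; apply: cvg_inner_product => //; first exact: cvg_within.
  exact: cvg_cst.
have : \bigcap_(p in C) sol p !=set0.
  move: (compC); rewrite compact_In0; apply.
    by exists sol => // p _; rewrite /sol setIA setIid.
  move=> D' D'C; pose s := finmap.enum_fset D'.
  have sC (i : 'I_(size s).+1) : C (nth p0 (p0 :: s) i).
    have /predU1P[->//|] : nth p0 (p0 :: s) i \in p0 :: s by rewrite mem_nth.
    by move=> /D'C; rewrite inE.
  have [x Cx xP] := variational_inequality_finite convC cf sC.
  exists x => p /= pD'; split => //=; rewrite subr_ge0.
  have ps : (index p (p0 :: s) < (size s).+1)%N.
    by rewrite index_mem inE; apply/orP; right.
  by have := xP (Ordinal ps); rewrite nth_index// -index_mem.
move=> [x xP]; exists x; first by have [] := xP p0 Cp0.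
by move=> p /xP[_] /=; rewrite subr_ge0.
Qed.

(** * Continuous selections of lower semi-continuous correspondences *)

Lemma convex_thickening (R : realType) (V : normedModType R) (A : set V)
    (e : R) :
  convex_set A -> convex_set [set u | exists2 v, A v & `|u - v| < e].
Proof.
move=> convA x y l; rewrite !inE => -[a Aa xa] [b Ab yb].
have l0 : 0 <= l%:num by [].
have l1 : 0 <= 1 - l%:num by rewrite subr_ge0.
exists (l%:num *: a + (1 - l%:num) *: b).
  by apply: convex_setP => //; rewrite l0 -subr_ge0.
rewrite [X in `|X|](_ : _ = l%:num *: (x - a) + (1 - l%:num) *: (y - b));
  last first.
  by rewrite !scalerBr opprD addrACA.
apply: (le_lt_trans (ler_normD _ _)); rewrite !normrZ !ger0_norm//.
have [m [xm ym me]] : exists m, [/\ `|x - a| <= m, `|y - b| <= m & m < e].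
  exists (Num.max `|x - a| `|y - b|).
  by rewrite !le_max !lexx orbT gt_max xa yb.
apply: le_lt_trans me; have := ler_wpM2l l0 xm; have := ler_wpM2l l1 ym; lra.
Qed.

(** Choose [y x] in [phi x]; by lower semi-continuity the values of [phi] on a
    ball of radius [r x] around [x] come within [e] of [y x].  Finitely many of
    these balls cover [C], and [f] averages the corresponding [y x] with weights
    supported in the balls.  Around each [z] only points [y x] within [e] of the
    convex set [phi z] are averaged. *)
Lemma approximate_selection (R : realType) (X Y : normedModType R) (C : set X)
    (phi : X -> set Y) (e : R) :
  compact C -> 0 < e -> (forall x, C x -> phi x !=set0) ->
  (forall x, C x -> convex_set (phi x)) -> corr_lsc_on C phi ->
  exists f : X -> Y, {within C, continuous f} /\
    forall x, C x -> exists2 v, phi x v & `|f x - v| < e.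
Proof.
move=> C_compact e0 phi0 phi_convex phi_lsc.
have local x : exists yr : Y * R, 0 < yr.2 /\ (C x ->
    forall z, C z -> `|x - z| < yr.2 ->
    exists2 v, phi z v & `|yr.1 - v| < e).
  have [Cx|nCx] := pselect (C x); last by exists (0, 1).
  have [y phiy] := phi0 x Cx.
  have /phi_lsc : (phi x `&` ball y e) !=set0.
    by exists y; split => //; exact: ballxx.
  move=> /(_ Cx (ball_open _ _)) /nbhs_ballP[r /= r0 rP].
  exists (y, r); split => // _ z Cz xz.
  have [|v [phiv yv]] := rP z _ Cz; first by rewrite -ball_normE.
  by exists v => //; move: yv; rewrite -ball_normE.
have {local}/choice[yr yrP] := local.
pose y x := (yr x).1; pose r x := (yr x).2.
have r0 x : 0 < r x by have [] := yrP x.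
have [D DC Dcover] : finite_subset_cover C (fun x => ball x (r x)) C.
  move: C_compact; rewrite compact_cover; apply => [x _|x Cx].
    exact: ball_open.
  by exists x => //; exact: ballxx.
pose s := finmap.enum_fset D.
pose t x z := r x - `|x - z|.
(* Twice the positive part of [t x z]. *)
pose w x z := `|t x z| + t x z.
have w0 x z : 0 <= w x z by rewrite /w -lerBlDr sub0r -normrN ler_norm.
have w_gt0 x z : (0 < w x z) = (`|x - z| < r x).
  rewrite -[RHS]subr_gt0 -/(t x z) /w; have [tz|tz] := lerP (t x z) 0.
    by rewrite ler0_norm// addNr ltxx.
  by rewrite gtr0_norm// addr_gt0.
pose W z := \sum_(x <- s) w x z.
have W_gt0 z : C z -> 0 < W z.
  move=> /Dcover[x /= xD xz]; rewrite /W (bigD1_seq x)//= ?finmap.fset_uniq//.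
  rewrite ltr_pwDl ?sumr_ge0// w_gt0.
  by move: xz; rewrite -ball_normE.
exists (fun z => (W z)^-1 *: \sum_(x <- s) w x z *: y x); split; last first.
  move=> z Cz; suff : [set u | exists2 v, phi z v & `|u - v| < e]
    ((W z)^-1 *: \sum_(x <- s) w x z *: y x) by [].
  apply: convex_barycentre => [|x|x xs|]; last exact: W_gt0.
  - exact/convex_thickening/phi_convex.
  - exact: w0.
  - rewrite w_gt0 => xz; have [_] := yrP x.
    have Cx : C x by move: (DC _ xs); rewrite inE.
    by move=> /(_ Cx z Cz xz).
apply/subspace_continuousP => z Cz.
apply: cvg_within_filter.
have cw x : w x u @[u --> z] --> w x z.
  have ct : t x u @[u --> z] --> t x z.
    apply: cvgB; first exact: cvg_cst.
    by apply: cvg_norm; apply: cvgB; [exact: cvg_cst|exact: cvg_id].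
  by apply: cvgD => //; exact: cvg_norm.
apply: cvgZ.
  apply: cvgV; first by rewrite gt_eqF// W_gt0.
  exact: (@cvg_sumr R R^o X (nbhs z) _).
by apply: (@cvg_sumr R Y X (nbhs z) _) => x; exact: cvgZr_tmp.
Qed.

Lemma corr_lsc_ball (R : realType) (X : topologicalType) (Y : normedModType R)
    (C : set X) (phi : X -> set Y) (f : X -> Y) (e : R) :
  corr_lsc_on C phi -> {within C, continuous f} ->
  corr_lsc_on C (fun x => phi x `&` [set v | `|f x - v| < e]).
Proof.
move=> phi_lsc /subspace_continuousP cf x Cx V oV [v [[phiv /= fv] Vv]].
have [d /= d0 dV] : nbhs_ball v V by apply/nbhs_ballP; exact: open_nbhs_nbhs.
pose m := (e - `|f x - v|) / 2.
have m0 : 0 < m by rewrite divr_gt0// subr_gt0.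
have dm0 : 0 < Num.min d m by rewrite lt_min d0.
have near_v : \forall z \near within C (nbhs x),
    (phi z `&` ball v (Num.min d m)) !=set0.
  apply: phi_lsc => //; first exact: ball_open.
  by exists v; split => //; exact: ballxx.
have near_f : \forall z \near within C (nbhs x), `|f x - f z| < m.
  by have /cvgrPdist_lt := cf x Cx; exact.
apply: filterS2 near_v near_f => z [v' [phiv' vv']] fz; exists v'.
move: vv'; rewrite -ball_normE /= lt_min => /andP[vd vm].
split; last by apply: dV; rewrite -ball_normE.
split => //=; have := ler_distD (f x) (f z) v'; have := ler_distD v (f x) v'.
by rewrite [`|f z - f x|]distrC; move: vm fz; rewrite /m; lra.
Qed.

Lemma convex_setI (R : realType) (V : lmodType R) (A B : set V) :
  convex_set A -> convex_set B -> convex_set (A `&` B).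
Proof.
move=> cA cB x y l; rewrite !inE => -[/mem_set Ax /mem_set Bx].
move=> [/mem_set Ay /mem_set By]; split; apply: set_mem; [exact: cA|exact: cB].
Qed.

Lemma convex_ball (R : realType) (V : normedModType R) (a : V) (e : R) :
  convex_set [set v | `|a - v| < e].
Proof.
have conv1 : convex_set [set a].
  by move=> x y l; rewrite !inE /= => -> ->; rewrite convmm.
suff -> : [set v | `|a - v| < e] =
    [set u | exists2 v, [set a] v & `|u - v| < e].
  exact: convex_thickening.
apply/seteqP; split => v /=; first by exists a => //; rewrite distrC.
by move=> [_ ->]; rewrite distrC.
Qed.

(** The [k]-th approximation [u k] is within [2^-k] of [zeta], and [u k.+1] is
    an approximate selection of [zeta] cut by the ball of radius [2^-k] around
    [u k]; consecutive approximations then differ by at most [2 * 2^-k]. *)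
Lemma michael_selection (R : realType) (X : normedModType R) (C : set X) N
    (zeta : X -> set 'rV[R]_N) :
  compact C -> (forall x, C x -> zeta x !=set0) ->
  (forall x, C x -> convex_set (zeta x)) ->
  (forall x, C x -> closed (zeta x)) ->
  corr_lsc_on C zeta ->
  exists2 f : X -> 'rV[R]_N, {within C, continuous f} &
    forall x, C x -> zeta x (f x).
Proof.
move=> C_compact zeta0 zeta_convex zeta_closed zeta_lsc.
pose h k : R := 2^-1 ^+ k.
have h0 k : 0 < h k by rewrite exprn_gt0// invr_gt0.
have hS k : h k.+1 = h k / 2 by rewrite /h exprSr.
pose approx k (f : X -> 'rV[R]_N) := {within C, continuous f} /\
  forall x, C x -> exists2 v, zeta x v & `|f x - v| < h k.
have [f0 f0P] : exists f0, approx 0 f0 by exact: approximate_selection.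
have step (kf : nat * (X -> 'rV[R]_N)) : exists g, approx kf.1 kf.2 ->
    approx kf.1.+1 g /\ forall x, C x -> `|g x - kf.2 x| <= 2 * h kf.1.
  case: kf => k f /=.
  have [[cf fP]|nf] := pselect (approx k f); last by exists f.
  pose phi x := zeta x `&` [set v | `|f x - v| < h k].
  have [|||||g [cg gP]] := @approximate_selection R X _ C phi (h k.+1).
  - exact: C_compact.
  - exact: h0.
  - by move=> x Cx; have [v] := fP x Cx; exists v.
  - by move=> x Cx; apply: convex_setI; [exact: zeta_convex|exact: convex_ball].
  - exact: corr_lsc_ball.
  exists g => _; split; first split => // x Cx.
    by have [v [zv _] gv] := gP x Cx; exists v.
  move=> x Cx; have [v [_ /= fv] gv] := gP x Cx.
  have := ler_distD v (g x) (f x); rewrite [`|v - _|]distrC.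
  by move: gv; rewrite hS; have := h0 k; lra.
have {step}/choice[F FP] := step.
pose u := fix u k := if k is j.+1 then F (j, u j) else f0.
have uP k : approx k (u k).
  by elim: k => [//|k IH]; have [] := FP (k, u k) IH.
have uS k x : C x -> `|u k.+1 x - u k x| <= 2 * h k.
  by move=> Cx; have [_] := FP (k, u k) (uP k); exact.
(* The bound telescopes: [2 * h j = 4 * (h j - h j.+1)]. *)
have uD k j x : C x -> `|u (j + k)%N x - u k x| <= 4 * (h k - h (j + k)%N).
  move=> Cx; elim: j => [|j IH]; first by rewrite !subrr normr0 mulr0.
  have := ler_distD (u (j + k)%N x) (u (j.+1 + k)%N x) (u k x).
  by have := uS (j + k)%N x Cx; rewrite addSn hS; lra.
have u_close k m x : (k <= m)%N -> C x -> `|u m x - u k x| <= 4 * h k.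
  move=> km Cx; have := uD k (m - k)%N x Cx; rewrite subnK//.
  by have := h0 m; lra.
have h_small e : 0 < e -> exists k, 4 * h k < e.
  move=> e0; have e4 : 0 < e / 4 by rewrite divr_gt0.
  have /cvgrPdist_lt/(_ _ e4)[k _ /(_ k (leqnn k)) /=] : h k @[k --> \oo] --> 0.
    by apply: cvg_expr; rewrite ger0_norm ?invr_ge0// invf_lt1// ltr1n.
  by rewrite sub0r normrN gtr0_norm// => hk; exists k; lra.
have u_cvg x : C x -> cvg (u k x @[k --> \oo]).
  move=> Cx; apply/cauchy_cvgP/cauchy_exP => e /h_small[k ke].
  exists (u k x); exists k => // m /= km; rewrite -ball_normE/=.
  by rewrite distrC (le_lt_trans (u_close _ _ _ km Cx)).
pose f x : 'rV[R]_N := lim (u k x @[k --> \oo]).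
have f_close k x : C x -> `|f x - u k x| <= 4 * h k.
  move=> Cx; apply: (@cvgr_to_le _ \oo _ _ (fun m => `|u m x - u k x|)).
    by apply: cvg_norm; apply: cvgB; [exact: u_cvg|exact: cvg_cst].
  by exists k => // m /= km; exact: u_close.
exists f.
  apply/subspace_continuousP => x Cx; apply/cvgrPdist_lt => e e0.
  have e3 : 0 < e / 3 by rewrite divr_gt0.
  have [k ke] := h_small _ e3.
  have /subspace_continuousP/(_ x Cx)/cvgrPdist_lt/(_ (e / 3)) := (uP k).1.
  move=> /(_ e3); apply: filterS2 (withinT C _) => y Cy uxy.
  have := ler_distD (u k x) (f x) (f y).
  have := ler_distD (u k y) (u k x) (f y).
  rewrite [`|u k y - f y|]distrC.
  by have := f_close k x Cx; have := f_close k y Cy; lra.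
move=> x Cx; apply: zeta_closed => // B /nbhs_ballP[e /= e0 eB].
have e2 : 0 < e / 2 by rewrite divr_gt0.
have [k ke] := h_small _ e2.
have [v zv uv] := (uP k).2 x Cx; exists v; split => //; apply: eB.
rewrite -ball_normE /=; have := ler_distD (u k x) (f x) v.
by have := f_close k x Cx; have := h0 k; lra.
Qed.

(** * The variational inequality for correspondences *)

Theorem corollary2p1 (R : realType) (N : nat) (C : set 'rV[R]_N)
    (zeta : 'rV[R]_N -> set 'rV[R]_N)
    (C_nonempty : C !=set0) (C_compact : compact C) (C_convex : convex_set C)
    (zeta_nonempty : forall x, C x -> zeta x !=set0)
    (zeta_convex : forall x, C x -> convex_set (zeta x))
    (zeta_compact : forall x, C x -> compact (zeta x))
    (zeta_lsc : corr_lsc_on C zeta) :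
  exists x z : 'rV[R]_N, [/\ C x, zeta x z &
    forall p : 'rV[R]_N, C p -> inner_product p z <= inner_product x z].
Proof.
have zeta_closed x : C x -> closed (zeta x).
  by move=> /zeta_compact; apply: compact_closed; exact: norm_hausdorff.
have [f cf f_zeta] :=
  michael_selection C_compact zeta_nonempty zeta_convex zeta_closed zeta_lsc.
have [x Cx xP] := variational_inequality C_nonempty C_compact C_convex cf.
by exists x, (f x); split => //; exact: f_zeta.
Qed.
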